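(* Let $X$ be a compact metric space, let $n\ge 1$ be an integer and let $M>0$. For any $\epsilon>0$ and any finite subset $\mathcal F\subset C(X)$, there exist $\delta>0$ and a finite subset $\mathcal G\subset C(X)$ satisfying the following: for any unital map $\phi: C(X)\to M_n$ (not assumed linear) with $\|\phi(f)\|\le M$ for all $f\in C(X)$ with $\|f\|\le 1$ such that $$\|\phi(\lambda_1 x+\lambda_2 y)-(\lambda_1\phi(x)+\lambda_2\phi(y))\|<\delta,\quad \|\phi(xy)-\phi(x)\phi(y)\|<\delta\quad\text{and}\quad \|\phi(x^* )-\phi(x)^*\|<\delta$$ for all $\lambda_1,\lambda_2\in\mathbb C$ with $|\lambda_i|\le 1$ ($i=1,2$) and all $x,y\in\mathcal G$, there exists a unital homomorphism $\psi: C(X)\to M_n$ such that $$\|\phi(f)-\psi(f)\|<\epsilon\quad\text{for all } f\in\mathcal F.$$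
   Context: $M_n$ is the $C^*$-algebra of $n\times n$ complex matrices; homomorphisms are $*$-homomorphisms; a unital map is one sending $1$ to $1$. *)

(* Defs.v *)
From HB Require Import structures.
From mathcomp Require Import all_boot all_order all_algebra.
From mathcomp Require Import sesquilinear spectral.
From mathcomp Require Import complex.
From mathcomp Require Import all_classical all_reals all_analysis.

Set Implicit Arguments.
Unset Strict Implicit.
Unset Printing Implicit Defensive.

Import Order.TTheory GRing.Theory Num.Theory.
Import numFieldNormedType.Exports.

Local Open Scope classical_set_scope.
Local Open Scope ring_scope.
Local Open Scope sesquilinear_scope.

(* [R[i]^o] is R[i] carrying the topology of its norm. *)
Definition cfun (R : realType) (X : topologicalType) : Type :=
  continuousType X R[i]^o.

HB.instance Definition _ (R : realType) (X : topologicalType) :=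
  gen_eqMixin (cfun R X).
HB.instance Definition _ (R : realType) (X : topologicalType) :=
  gen_choiceMixin (cfun R X).

Section ContinuousFunctionAlgebra.
Context {R : realType} {X : topologicalType}.

Lemma cfunP (f : cfun R X) : continuous (f : X -> R[i]^o).
Proof. exact: (@cts_fun _ _ f). Qed.

Definition mkcfun (f : X -> R[i]^o) (cf : continuous f) : cfun R X :=
  (mkcts cf : continuousType X R[i]^o).

Definition cfun_pred : {pred X -> R[i]^o} := mem [set f | continuous f].

Let cfun_sub (f : X -> R[i]^o) (cf : f \in cfun_pred) : cfun R X :=
  mkcfun (set_mem cf).

Let cfun_rect (K : cfun R X -> Type) :
  (forall f (cf : f \in cfun_pred), K (cfun_sub cf)) -> forall u, K u.
Proof.
move=> Ksub u.
have cu : (u : X -> R[i]^o) \in cfun_pred by rewrite inE; exact: cfunP.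
by have := Ksub _ cu; congr (K _); exact/continuousEP.
Qed.

Let cfun_valP f (cf : f \in cfun_pred) : cfun_sub cf = f :> (X -> R[i]^o).
Proof. by []. Qed.

HB.instance Definition _ := isSub.Build _ _ (cfun R X) cfun_rect cfun_valP.

Lemma cfun_subring_closed : subring_closed cfun_pred.
Proof.
split=> [|f g /set_mem cf /set_mem cg|f g /set_mem cf /set_mem cg];
  apply/mem_set => x.
- exact: cvg_cst.
- exact: continuousB (cf x) (cg x).
- exact: (@continuousM R[i] _ _ _ x (cf x) (cg x)).
Qed.

HB.instance Definition _ := GRing.isSubringClosed.Build _
  cfun_pred cfun_subring_closed.
HB.instance Definition _ := 
  GRing.SubChoice_isSubComPzRing.Build _ _ (cfun R X) (subringClosedP _).

Lemma cfun_scaler_closed : scaler_closed cfun_pred.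
Proof.
move=> k f /set_mem cf; apply/mem_set => x.
exact: continuousZl_tmp (cf x).
Qed.

HB.instance Definition _ := GRing.isScaleClosed.Build _ _
  cfun_pred cfun_scaler_closed.
HB.instance Definition _ := [SubZmodule_isSubLmodule of cfun R X by <:].

Lemma cfun_star_continuous (f : cfun R X) :
  continuous ((fun x => (f x : R[i])^*) : X -> R[i]^o).
Proof.
move=> x; apply/cvgrPdist_lt => e e0.
have /cvgrPdist_lt/(_ _ e0) := @cfunP f x.
apply: filterS => y; rewrite -rmorphB.
by rewrite norm_conjC.
Qed.

Definition cfun_star (f : cfun R X) : cfun R X :=
  mkcfun (@cfun_star_continuous f).

Lemma cfun1E x : (1 : cfun R X) x = 1. Proof. by []. Qed.
Lemma cfunDE (f g : cfun R X) x : (f + g) x = f x + g x. Proof. by []. Qed.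
Lemma cfunME (f g : cfun R X) x : (f * g) x = f x * g x. Proof. by []. Qed.
Lemma cfunZE (k : R[i]) (f : cfun R X) x : (k *: f) x = k * f x.
Proof. by []. Qed.
Lemma cfun_starE (f : cfun R X) x : cfun_star f x = (f x)^*.
Proof. by []. Qed.

(* The supremum norm when X is compact (0 when X is empty). The modulus
   [normc] is R-valued, whereas [`|z|] lives in R[i]. *)
Definition cfun_norm (f : cfun R X) : R :=
  sup [set ComplexField.Normc.normc (f x) | x in [set: X]].

End ContinuousFunctionAlgebra.

Definition l2norm (R : realType) (n : nat) (v : 'cV[R[i]]_n) : R :=
  Num.sqrt (\sum_(j < n) ComplexField.Normc.normc (v j 0) ^+ 2).

Definition opnorm (R : realType) (n : nat) (A : 'M[R[i]]_n) : R :=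
  sup [set l2norm (A *m v) | v in [set v : 'cV[R[i]]_n | l2norm v <= 1]].

Definition unital_star_homomorphism (R : realType) (X : topologicalType)
    (n : nat) (psi : cfun R X -> 'M[R[i]]_n) : Prop :=
  [/\ linear psi, monoid_morphism psi &
      forall f, psi (cfun_star f) = (psi f)^t* ].

(* Main.v *)
Require Import Defs.
From mathcomp Require Import all_boot all_order all_algebra.
From mathcomp Require Import sesquilinear spectral.
From mathcomp Require Import complex.
From mathcomp Require Import all_classical all_reals all_analysis.

Import Order.TTheory GRing.Theory Num.Theory.
Import numFieldNormedType.Exports.
Import ComplexField.Normc.
Local Open Scope classical_set_scope.
Local Open Scope ring_scope.
Local Open Scope sesquilinear_scope.

(** If no [delta] and [G] work, the sets of counterexamples for the pairs
    [(delta, G)] generate a proper filter on the maps from [C(X)] to [M_n];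
    refine it to an ultrafilter. Each entry of [phi f] is bounded along the
    ultrafilter, hence converges, since [M_n] is finite dimensional. The limit
    is exactly linear, multiplicative and star-preserving, and it is close to
    [phi] on the finite set [F] for ultrafilter-many counterexamples [phi],
    which is absurd. *)

(** * The real-valued modulus and convergence in [R[i]] *)

Section Modulus.
Context {R : realType}.
Implicit Types z w : R[i].

Lemma normr_normc z : `|z| = (normc z)%:C%C. Proof. by []. Qed.

Lemma normc_ge0 z : 0 <= normc z.
Proof. by rewrite -lecR; exact: (normr_ge0 z). Qed.

Lemma normcD_le z w : normc (z + w) <= normc z + normc w.
Proof. exact: (@le_normcD R z w). Qed.

Lemma dist_normc_le z w : `|normc z - normc w| <= normc (z - w).
Proof.
have zw : normc z <= normc (z - w) + normc w.
  by rewrite -{1}(subrK w z); exact: normcD_le.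
have wz : normc w <= normc (z - w) + normc z.
  rewrite -[normc (z - w)](@normcN R (z - w)) opprB -{1}(subrK z w).
  exact: normcD_le.
by rewrite ler_norml lerBlDr zw andbT lerNl opprB lerBlDr.
Qed.

Lemma normc_le_ReIm z : normc z <= `|complex.Re z| + `|complex.Im z|.
Proof.
case: z => a b /=; rewrite -[leRHS]ger0_norm ?addr_ge0// -sqrtr_sqr.
rewrite ler_wsqrtr// sqrrD !real_normK ?num_real// lerD2r lerDl.
by rewrite mulrn_wge0// mulr_ge0.
Qed.

Lemma Re_le_normc z : `|complex.Re z| <= normc z.
Proof. by rewrite -lecR; exact: normc_ge_Re. Qed.

Lemma Im_le_normc z : `|complex.Im z| <= normc z.
Proof.
by case: z => a b /=; rewrite -sqrtr_sqr ler_wsqrtr// lerDr sqr_ge0.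
Qed.

Lemma normc_real (c : R) : 0 <= c -> normc c%:C%C = c.
Proof. by move=> c0; rewrite /= expr0n addr0 sqrtr_sqr ger0_norm. Qed.

Lemma normc_conj z : normc z^* = normc z.
Proof. exact: (congr1 (@complex.Re R) (norm_conjC z)). Qed.

Lemma cvg_normcP T (F : set_system T) (FF : Filter F) (u : T -> R[i]^o)
    (l : R[i]^o) :
  u t @[t --> F] --> l <->
  forall e : R, 0 < e -> \forall t \near F, normc (l - u t) < e.
Proof.
split=> [/cvgrPdist_lt ul e e0|ul].
  have e0' : 0 < e%:C%C by rewrite ltcR.
  by apply: filterS (ul _ e0') => t; rewrite normr_normc ltcR.
apply/cvgrPdist_lt => e; rewrite ltcE => /andP[/eqP ei er].
(* The topology of [R[i]] is tested with a complex [e]; the order makes a positive [e] real, so real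
   radii suffice. *)
have -> : e = (complex.Re e)%:C%C by case: e ei er => a b /= ->.
by apply: filterS (ul _ er) => t; rewrite normr_normc ltcR.
Qed.

Lemma cvg_sum_seq T (F : set_system T) (FF : Filter F) (I : Type) (r : seq I)
    (u : I -> T -> R[i]^o) (l : I -> R[i]^o) :
  (forall k, u k t @[t --> F] --> l k) ->
  (\sum_(k <- r) u k t) @[t --> F] --> \sum_(k <- r) l k.
Proof.
move=> ul; elim: r => [|k r IHr].
  by under eq_cvg => t do rewrite big_nil; rewrite big_nil; exact: cvg_cst.
under eq_cvg => t do rewrite big_cons; rewrite big_cons.
by apply: cvgD IHr; exact: ul.
Qed.

End Modulus.

(** * Bounded functions converge along an ultrafilter *)

Section UltrafilterLimits.
Context {R : realType} {T : Type} {U : set_system T} {UU : UltraFilter U}.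

Lemma ultra_bounded_cvg (u : T -> R) (B : R) :
  (\forall t \near U, `|u t| <= B) -> exists l : R, u t @[t --> U] --> l.
Proof.
move=> uB; have : (u @ U) `[- B, B]%classic.
  by apply: filterS uB => t /=; rewrite in_itv /= ler_norml.
move=> /(segment_compact (fmap_proper_filter _ _)) [l [_ ul]].
exists l => V lV.
have [//|UV] := in_ultra_setVsetC (u @^-1` V) UU.
by have [y [/= nVy Vy]] := ul _ _ (UV : (u @ U) (~` V)) lV.
Qed.

Lemma ultra_bounded_cvgC (u : T -> R[i]^o) (B : R) :
  (\forall t \near U, normc (u t) <= B) ->
  exists l : R[i]^o, u t @[t --> U] --> l.
Proof.
move=> uB.
have [a /cvgrPdist_lt ua] : exists a : R, complex.Re (u t) @[t --> U] --> a.
  apply: (@ultra_bounded_cvg _ B).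
  by apply: filterS uB => t; exact/le_trans/Re_le_normc.
have [b /cvgrPdist_lt ub] : exists b : R, complex.Im (u t) @[t --> U] --> b.
  apply: (@ultra_bounded_cvg _ B).
  by apply: filterS uB => t; exact/le_trans/Im_le_normc.
exists (a +i* b)%C; apply/cvg_normcP => e e0.
have e20 : 0 < e / 2 by rewrite divr_gt0.
apply: filterS2 (ua _ e20) (ub _ e20) => t at_ bt.
apply: le_lt_trans (normc_le_ReIm _) _; rewrite [ltRHS]splitr.
by move: at_ bt; case: (u t) => p q /= at_ bt; exact: ltrD.
Qed.

End UltrafilterLimits.

(** * The operator norm is equivalent to the size of the entries *)

Section OperatorNorm.
Context {R : realType} {n : nat}.
Implicit Types A B : 'M[R[i]]_n.

Lemma normc_le_l2norm (v : 'cV[R[i]]_n) j : normc (v j 0) <= l2norm v.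
Proof.
rewrite -[leLHS]ger0_norm ?normc_ge0// -sqrtr_sqr ler_wsqrtr//.
by rewrite (bigD1 j)//= lerDl sumr_ge0// => i _; rewrite sqr_ge0.
Qed.

Lemma l2norm_le_sum (v : 'cV[R[i]]_n) : l2norm v <= \sum_j normc (v j 0).
Proof.
have s0 : 0 <= \sum_j normc (v j 0) by rewrite sumr_ge0// => j _; exact: normc_ge0.
rewrite -[leRHS]ger0_norm// -sqrtr_sqr ler_wsqrtr// expr2 mulr_suml.
apply: ler_sum => j _; rewrite expr2 ler_wpM2l ?normc_ge0//.
rewrite (bigD1 j)//= lerDl sumr_ge0// => i _; exact: normc_ge0.
Qed.

Lemma l2norm_mulmx_le A (v : 'cV[R[i]]_n) :
  l2norm v <= 1 -> l2norm (A *m v) <= \sum_i \sum_j normc (A i j).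
Proof.
move=> v1; apply: le_trans (l2norm_le_sum _) _; apply: ler_sum => i _.
rewrite mxE; elim/big_ind2 : _ => [|x1 y1 x2 y2 h1 h2|j _].
- by rewrite normc0.
- by apply: le_trans (normcD_le _ _) _; exact: lerD.
- rewrite normcM ler_piMr ?normc_ge0//.
  exact: le_trans (normc_le_l2norm _ _) v1.
Qed.

Lemma l2norm_delta (j : 'I_n) : l2norm (delta_mx j 0 : 'cV[R[i]]_n) = 1.
Proof.
rewrite /l2norm (bigD1 j)//= big1 => [|i /negbTE ij].
  by rewrite mxE !eqxx normc1 expr1n addr0 sqrtr1.
by rewrite mxE ij (normc0 R) expr0n.
Qed.

Lemma opnorm_le_sum A : opnorm A <= \sum_i \sum_j normc (A i j).
Proof.
apply: ge_sup => [|_ [v /= v1 <-]]; last exact: l2norm_mulmx_le.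
(* Bounding a [sup] from above requires a nonempty set; the zero vector provides an element. *)
exists (l2norm (A *m 0)), 0 => //=; rewrite /l2norm big1 ?sqrtr0// => j _.
by rewrite mxE normc0 expr0n.
Qed.

(** [A i j] is a coordinate of the image of the unit vector [delta_mx j 0]. *)
Lemma entry_le_opnorm A i j : normc (A i j) <= opnorm A.
Proof.
apply: (@le_trans _ _ (l2norm (A *m delta_mx j 0))).
  have <- : col j A i 0 = A i j by rewrite mxE.
  rewrite colE.
  exact: normc_le_l2norm.
apply: ub_le_sup.
  by exists (\sum_i \sum_j normc (A i j)) => _ [v /= v1 <-]; exact: l2norm_mulmx_le.
by exists (delta_mx j 0) => //=; rewrite l2norm_delta.
Qed.

End OperatorNorm.

(** * Bounds on continuous functions *)

Section SupNorm.
Context {R : realType} {X : topologicalType}.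
Implicit Types f : cfun R X.

Lemma cfun_norm_le f (c : R) :
  0 <= c -> (forall x, normc (f x) <= c) -> cfun_norm f <= c.
Proof.
(* For empty [X] the norm is the default value [sup set0 = 0], whence the condition [0 <= c]. *)
move=> c0 fc; rewrite /cfun_norm; have [->|/set0P ne] := eqVneq [set normc (f x) | x in [set: X]] set0.
  by rewrite sup0.
by apply: ge_sup => // _ [x _ <-].
Qed.

Lemma cfun_bounded f : compact [set: X] ->
  exists2 N : R, 0 < N & forall x, normc (f x) <= N.
Proof.
move=> cX; have cf : continuous (fun x => normc (f x)).
  move=> x; apply/cvgrPdist_lt => e e0.
  have /cvg_normcP/(_ _ e0) := @cfunP _ _ f x.
  by apply: filterS => y; exact/le_lt_trans/dist_normc_le.
have /compact_bounded := continuous_compact (continuous_subspaceT cf) cX.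
move=> [B [_ fB]]; exists (`|B| + 1) => [|x]; first by rewrite ltr_wpDl.
rewrite -[leLHS]ger0_norm ?normc_ge0//.
by apply: (fB (`|B| + 1)) => //; rewrite (le_lt_trans (ler_norm B))// ltrDl.
Qed.

End SupNorm.

(** * The limit of approximate homomorphisms along an ultrafilter *)

Section LimitHomomorphism.
Context {R : realType} {X : topologicalType} {n : nat}.

Definition almost_hom (delta : R) (G : set (cfun R X))
    (phi : cfun R X -> 'M[R[i]]_n) : Prop :=
  forall (l1 l2 : R[i]) (x y : cfun R X),
    `|l1| <= 1 -> `|l2| <= 1 -> G x -> G y ->
    [/\ opnorm (phi (l1 *: x + l2 *: y)
                - (l1 *: phi x + l2 *: phi y)) < delta,
        opnorm (phi (x * y) - phi x * phi y) < delta &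
        opnorm (phi (cfun_star x) - (phi x)^t*) < delta].

Lemma almost_homS {delta delta' : R} {G G' : set (cfun R X)}
    {phi : cfun R X -> 'M[R[i]]_n} :
  delta <= delta' -> G' `<=` G -> almost_hom delta G phi ->
  almost_hom delta' G' phi.
Proof.
move=> dd GG ah l1 l2 x y l1_1 l2_1 /GG Gx /GG Gy.
by have [h1 h2 h3] := ah l1 l2 x y l1_1 l2_1 Gx Gy; split; exact: lt_le_trans dd.
Qed.

(* Only the unit ball is controlled, and [phi] is not homogeneous: compare
   [phi f] with [N *: phi (N^-1 *: f)], where [N] bounds [f]. *)
Lemma almost_hom_bounded (M N : R) (f : cfun R X)
    (phi : cfun R X -> 'M[R[i]]_n) :
  1 <= N -> (forall x, normc (f x) <= N) ->
  (forall g, cfun_norm g <= 1 -> opnorm (phi g) <= M) ->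
  almost_hom 1 [set f] phi ->
  forall i j, normc (phi f i j) <= N * (M + 1).
Proof.
move=> N1 fN phiM ah i j; have N0 : 0 < N by exact: lt_le_trans N1.
pose c : R[i] := (N^-1)%:C%C.
have ec : normc c = N^-1 by rewrite normc_real// invr_ge0 ltW.
have c1 : `|c| <= 1 by rewrite normr_normc ec lecR invf_le1.
(* A zero second scalar turns the linearity defect into a homogeneity defect for [c *: f]. *)
have [+ _ _] := ah c 0 f f c1 (eq_ind_r (fun z => z <= 1) ler01 (normr0 _)) erefl erefl.
rewrite !scale0r !addr0 => cd.
have cM : opnorm (phi (c *: f)) <= M.
  apply: phiM; apply: (cfun_norm_le _ _ ler01) => x.
  by rewrite cfunZE normcM ec ler_pdivrMl// mulr1.
rewrite -ler_pdivrMl// -ec -normcM.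
have -> : c * phi f i j =
    phi (c *: f) i j - (phi (c *: f) - c *: phi f) i j.
  by rewrite !mxE opprB addrC subrK.
apply: le_trans (normcD_le _ _) _; apply: lerD.
  exact: le_trans (entry_le_opnorm _ _ _) cM.
rewrite [normc (- _)](@normcN R); apply: le_trans (entry_le_opnorm _ _ _) _.
exact: ltW.
Qed.

Context {T : Type} {U : set_system T} {UU : UltraFilter U}.
Variables (M : R) (phi : T -> cfun R X -> 'M[R[i]]_n).
Hypothesis cX : compact [set: X].
Hypothesis phi1 : \forall t \near U, phi t 1 = 1.
Hypothesis phiM :
  \forall t \near U, forall f, cfun_norm f <= 1 -> opnorm (phi t f) <= M.
Hypothesis phiU : forall (delta : R) (G : set (cfun R X)),
  0 < delta -> finite_set G -> \forall t \near U, almost_hom delta G (phi t).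

Lemma entry_cvg f i j :
  exists l : R[i]^o, (phi t f i j : R[i]^o) @[t --> U] --> l.
Proof.
have [N N0 fN] := cfun_bounded f cX.
(* [N + 1] instead of [N] meets the requirement that the bound on [f] be at least 1. *)
apply: (@ultra_bounded_cvgC _ _ _ _ (fun t => phi t f i j) ((N + 1) * (M + 1))).
apply: filterS2 phiM (phiU _ _ ltr01 (finite_set1 f)) => t phitM aht.
apply: (almost_hom_bounded _ (N + 1) f _ _ _ phitM aht).
  by rewrite lerDr ltW.
by move=> x; rewrite (le_trans (fN x))// lerDl.
Qed.

Definition limit_hom (f : cfun R X) : 'M[R[i]]_n :=
  \matrix_(i, j) sval (cid (entry_cvg f i j)).

Lemma limit_homE f i j :
  (phi t f i j : R[i]^o) @[t --> U] --> (limit_hom f i j : R[i]^o).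
Proof. by rewrite mxE; case: cid. Qed.

(** There are finitely many entries, so their convergence is simultaneous and gives convergence in
    operator norm. *)
Lemma limit_hom_opnorm f e : 0 < e ->
  \forall t \near U, opnorm (phi t f - limit_hom f) < e.
Proof.
(* The successor keeps the denominator positive when [n = 0] and makes the sum of [n * n] copies of
   [d] strictly smaller than [e]. *)
move=> e0; pose d := e / (n * n).+1%:R.
have d0 : 0 < d by rewrite divr_gt0.
have : \forall t \near U, forall i j, normc (limit_hom f i j - phi t f i j) < d.
  apply: filter_forall => i; apply: filter_forall => j.
  by have /cvg_normcP/(_ _ d0) := limit_homE f i j.
apply: filterS => t td; apply: le_lt_trans (opnorm_le_sum _) _.
apply: (@le_lt_trans _ _ (\sum_(i < n) \sum_(j < n) d)).
  apply: ler_sum => i _; apply: ler_sum => j _.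
  have -> : (phi t f - limit_hom f) i j = - (limit_hom f i j - phi t f i j).
    by rewrite opprB !mxE.
  by rewrite [normc (- _)](@normcN R); exact: ltW (td i j).
rewrite !sumr_const !card_ord -mulrnA -mulr_natr /d mulrAC ltr_pdivrMr//.
by rewrite ltr_pM2l// ltr_nat.
Qed.

(** Turns approximate identities into exact ones: the entries of [phi t f - g t] tend both to those
    of [limit_hom f - L] and to 0, and limits in a Hausdorff space are unique. *)
Lemma limit_hom_eq f (g : T -> 'M[R[i]]_n) (L : 'M[R[i]]_n) :
  (forall e, 0 < e -> \forall t \near U, opnorm (phi t f - g t) < e) ->
  (forall i j, (g t i j : R[i]^o) @[t --> U] --> (L i j : R[i]^o)) ->
  limit_hom f = L.
Proof.
move=> fg gL; apply/matrixP => i j.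
apply/eqP; rewrite -subr_eq0; apply/eqP.
have lim_diff : (phi t f i j - g t i j : R[i]^o) @[t --> U] -->
    (limit_hom f i j - L i j : R[i]^o).
  by apply: cvgB; [exact: limit_homE|exact: gL].
have lim0 : (phi t f i j - g t i j : R[i]^o) @[t --> U] --> (0 : R[i]^o).
  apply/cvg_normcP => e /fg; apply: filterS => t; apply: le_lt_trans.
  rewrite sub0r [normc (- _)](@normcN R).
  by have := entry_le_opnorm (phi t f - g t) i j; rewrite !mxE.
exact: (cvg_unique (@norm_hausdorff _ R[i]^o) lim_diff lim0).
Qed.

Lemma limit_hom_comb (l1 l2 : R[i]) x y : `|l1| <= 1 -> `|l2| <= 1 ->
  limit_hom (l1 *: x + l2 *: y) = l1 *: limit_hom x + l2 *: limit_hom y.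
Proof.
move=> l1_1 l2_1.
apply: (limit_hom_eq _ (fun t => l1 *: phi t x + l2 *: phi t y)) => [e e0|i j].
  apply: filterS (phiU _ _ e0 (finite_set2 x y)) => t.
  move=> /(_ l1 l2 x y l1_1 l2_1 (or_introl erefl) (or_intror erefl)).
  by move=> [h _ _]; exact: h.
have combE (A B : 'M[R[i]]_n) :
    (l1 *: A + l2 *: B) i j = l1 * A i j + l2 * B i j by rewrite !mxE.
under eq_cvg => t do rewrite combE; rewrite combE.
by apply: cvgD; apply: (@cvgM R[i]); (exact: cvg_cst || exact: limit_homE).
Qed.

Lemma limit_homM x y : limit_hom (x * y) = limit_hom x * limit_hom y.
Proof.
apply: (limit_hom_eq _ (fun t => phi t x * phi t y)) => [e e0|i j].
  apply: filterS (phiU _ _ e0 (finite_set2 x y)) => t.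
  (* The multiplicative estimate does not involve the scalars; any two in the unit disc serve. *)
  move=> /(_ 0 0 x y); rewrite normr0.
  move=> /(_ ler01 ler01 (or_introl erefl) (or_intror erefl)).
  by move=> [_ h _]; exact: h.
under eq_cvg => t do rewrite mxE; rewrite mxE.
apply: cvg_sum_seq => k; apply: (@cvgM R[i]); exact: limit_homE.
Qed.

Lemma limit_hom_star x : limit_hom (cfun_star x) = (limit_hom x)^t*.
Proof.
apply: (limit_hom_eq _ (fun t => (phi t x)^t*)) => [e e0|i j].
  apply: filterS (phiU _ _ e0 (finite_set1 x)) => t.
  by move=> /(_ 0 0 x x); rewrite normr0 => /(_ ler01 ler01 erefl erefl)[_ _ h]; exact: h.
apply/cvg_normcP => e e0.
have /cvg_normcP/(_ _ e0) := limit_homE x j i.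
apply: filterS => t.
have -> : (limit_hom x)^t* i j - (phi t x)^t* i j =
    (limit_hom x j i - phi t x j i)^*.
  by rewrite rmorphB; congr (_ - _); rewrite !mxE.
by rewrite normc_conj.
Qed.

Lemma limit_hom1 : limit_hom 1 = 1.
Proof.
apply: (limit_hom_eq _ (fun=> 1)) => [e e0|i j]; last exact: cvg_cst.
apply: filterS phi1 => t ->; rewrite subrr.
apply: le_lt_trans (opnorm_le_sum _) _; rewrite big1// => i _.
by rewrite big1// => j _; rewrite mxE normc0.
Qed.

Lemma limit_homZ (a : R[i]) x : limit_hom (a *: x) = a *: limit_hom x.
Proof.
have small b y : `|b| <= 1 -> limit_hom (b *: y) = b *: limit_hom y.
  move=> b1; have := limit_hom_comb b 0 y 0 b1.
  by rewrite normr0 !scale0r !addr0 => ->.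
have [a1|a1] := real_leP (normr_real a) (real1 _); first exact: small.
have a0 : a != 0 by rewrite -normr_gt0 (lt_trans _ a1).
have aV1 : `|a^-1| <= 1 by rewrite normfV invf_le1 ?ltW// (lt_trans _ a1).
have := small a^-1 (a *: x) aV1; rewrite scalerA mulVf// scale1r => ->.
by rewrite scalerA mulfV// scale1r.
Qed.

Lemma limit_hom_unital_star_homomorphism : unital_star_homomorphism limit_hom.
Proof.
split; [|split|]; [|exact: limit_hom1|exact: limit_homM|exact: limit_hom_star].
move=> a x y; rewrite -limit_homZ -[a *: x]scale1r -[y in LHS]scale1r.
by rewrite limit_hom_comb ?normr1// !scale1r.
Qed.

Lemma exists_limit_hom : exists2 psi : cfun R X -> 'M[R[i]]_n,
  unital_star_homomorphism psi &
  forall f e, 0 < e -> \forall t \near U, opnorm (phi t f - psi f) < e.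
Proof.
exists limit_hom; first exact: limit_hom_unital_star_homomorphism.
exact: limit_hom_opnorm.
Qed.

End LimitHomomorphism.

(** * The ultrafilter of counterexamples *)

Theorem theorem2p2 (R : realType) (X : metricType R) (n : nat) (M : R) :
  compact [set: X] -> (1 <= n)%N -> 0 < M ->
  forall (eps : R) (F : set (cfun R X)), 0 < eps -> finite_set F ->
  exists (delta : R) (G : set (cfun R X)),
    [/\ 0 < delta, finite_set G &
    forall phi : cfun R X -> 'M[R[i]]_n,
      phi 1 = 1 ->
      (forall f, cfun_norm f <= 1 -> opnorm (phi f) <= M) ->
      (forall (l1 l2 : R[i]) (x y : cfun R X),
         `|l1| <= 1 -> `|l2| <= 1 -> G x -> G y ->
         [/\ opnorm (phi (l1 *: x + l2 *: y)
                     - (l1 *: phi x + l2 *: phi y)) < delta,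
             opnorm (phi (x * y) - phi x * phi y) < delta &
             opnorm (phi (cfun_star x) - (phi x)^t*) < delta]) ->
      exists2 psi : cfun R X -> 'M[R[i]]_n,
        unital_star_homomorphism psi &
        forall f, F f -> opnorm (phi f - psi f) < eps].
Proof.
move=> cX _ _ eps F e0 finF; apply: contrapT => nodG.
pose near_hom (phi : cfun R X -> 'M[R[i]]_n) := exists2 psi,
  unital_star_homomorphism psi & forall f, F f -> opnorm (phi f - psi f) < eps.
pose bad := [set phi : cfun R X -> 'M[R[i]]_n | [/\ phi 1 = 1,
  forall f, cfun_norm f <= 1 -> opnorm (phi f) <= M & ~ near_hom phi]].
pose D := [set dG : R * set (cfun R X) | 0 < dG.1 /\ finite_set dG.2].
pose B (dG : R * set (cfun R X)) := bad `&` almost_hom dG.1 dG.2.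
have Bfilter : Filter (filter_from D B).
  apply: filter_from_filter; first by exists (1, set0); split.
  move=> [d1 G1] [d2 G2] [/= d10 fG1] [/= d20 fG2].
  (* A smaller [delta] and a larger [G] are more restrictive, so this basic set lies in both given
     ones. *)
  exists (Num.min d1 d2, G1 `|` G2).
    by split; rewrite /= ?lt_min ?d10// finite_setU.
  move=> phi [bphi ah]; split; split => //=; apply: almost_homS ah => /=.
  - by rewrite ge_min lexx.
  - exact: subsetUl.
  - by rewrite ge_min lexx orbT.
  - exact: subsetUr.
have Bproper : ProperFilter (filter_from D B).
  (* Properness is the negated conclusion: were [B (d, G)] empty, the pair [(d, G)] would satisfy
     the theorem. *)
  apply: filter_from_proper => -[d G] [/= d0 fG]; apply: contrapT => B0.
  apply: nodG; exists d, G; split=> // phi h1 hM hG; apply: contrapT => nphi.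
  by apply: B0; exists phi.
have [U [UU BU]] := ultraFilterLemma Bproper.
have Ubad : U bad.
  apply: BU; exists (1, set0) => [|phi []//].
  by split => /=.
have U1 : \forall phi \near U, phi 1 = 1 by apply: filterS Ubad => phi [].
have UM : \forall phi \near U, forall f, cfun_norm f <= 1 -> opnorm (phi f) <= M.
  by apply: filterS Ubad => phi [].
have UG d G : 0 < d -> finite_set G -> \forall phi \near U, almost_hom d G phi.
  by move=> d0 fG; apply: BU; exists (d, G) => // phi [].
(* The index type is the type of all maps, and the family of maps is the identity. *)
have [psi psi_hom Upsi] := exists_limit_hom M id cX U1 UM UG.
have UF : \forall phi \near U, forall f, F f -> opnorm (phi f - psi f) < eps.
  (* The estimate for each single [f] holds on a member of [U]; finiteness of [F] allows these
     members to be intersected. *)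
  have /finite_seqP[s ->] := finF.
  elim: s => [|f s IHs]; first by apply: filterS Ubad.
  apply: filterS2 (Upsi f eps e0) IHs => phi hf hs g /=.
  by rewrite inE => /predU1P[->//|]; exact: hs.
(* Members of a proper filter are nonempty, so some bad map is [eps]-close to [psi] on [F]. *)
have [phi [[_ _ nphi] phiF]] := filter_ex (filterI Ubad UF).
by apply: nphi; exists psi.
Qed.
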